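(* Let $s,t$ be two integers, let $k$ be a positive integer, and let $T$ be a tree of order $s$. Then $$\operatorname{gr}_k(T,K_t)\leq (s-1)^{kt}.$$
   Context: The order of a graph is its number of vertices. A $k$-edge-coloring of $K_n$ assigns to each edge one of $k$ colors (not all colors need be used, and it need not be proper). A subgraph is rainbow if all its edges have distinct colors, and monochromatic if all its edges have the same color. For graphs $G,H$ and a positive integer $k$, the Gallai-Ramsey number $\operatorname{gr}_k(G,H)$ is the minimum integer $n$ such that every $k$-edge-coloring of the complete graph $K_n$ contains a rainbow copy of $G$ or a monochromatic copy of $H$.
   Formalization: The tree T is assumed to have order s at least 3, because the inequality fails for s = 1 with t ≥ 1 (1 > 0) and for s = 2 with t ≥ 2 (2 > 1); t is a nonnegative integer. *)

(* Defs.v *)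
From mathcomp Require Import all_boot.

Set Implicit Arguments.
Unset Strict Implicit.
Unset Printing Implicit Defensive.

Record sgraph := SGraph {
  vertex :> finType;
  adj : rel vertex;
  adj_sym : symmetric adj;
  adj_irrefl : irreflexive adj
}.

Definition graph_order (G : sgraph) : nat := #|G|.

Definition edges (G : sgraph) : {set {set G}} :=
  [set e | [exists x, exists y, adj x y && (e == [set x; y])]].

Definition complete_adj (n : nat) : rel 'I_n := [rel x y | x != y].

Lemma complete_adj_sym n : symmetric (@complete_adj n).
Proof. by move=> x y; rewrite /complete_adj /= eq_sym. Qed.

Lemma complete_adj_irrefl n : irreflexive (@complete_adj n).
Proof. by move=> x; rewrite /complete_adj /= eqxx. Qed.

Definition complete (n : nat) : sgraph :=
  SGraph (@complete_adj_sym n) (@complete_adj_irrefl n).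

Definition connected (G : sgraph) : Prop :=
  0 < graph_order G /\ forall x y : G, connect (@adj G) x y.

(* An adjacent pair [:: x; y] satisfies [ucycle]: genuine cycles are those of
   length at least 3. *)
Definition acyclic (G : sgraph) : Prop :=
  forall p : seq G, ucycle (@adj G) p -> size p <= 2.

Definition is_tree (G : sgraph) : Prop := connected G /\ acyclic G.

(* Only the colors of the edges of K_n matter: the values taken on sets that are
   not pairs are never inspected below. *)
Definition edge_coloring (n k : nat) := {set complete n} -> 'I_k.

Section Copies.
Variables (n k : nat) (c : edge_coloring n k) (G : sgraph).

(* An injective f : G -> complete n is a (not necessarily induced) copy of G in
   K_n, with edges f @: e for e an edge of G. *)
Definition has_rainbow_copy : Prop :=
  exists2 f : G -> complete n, injective f &
    {in edges G &, forall e1 e2 : {set G}, c (f @: e1) = c (f @: e2) -> e1 = e2}.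

Definition has_monochromatic_copy : Prop :=
  exists2 f : G -> complete n, injective f &
    {in edges G &, forall e1 e2 : {set G}, c (f @: e1) = c (f @: e2)}.

End Copies.

Definition gallai_ramsey_prop (k : nat) (G H : sgraph) (n : nat) : Prop :=
  forall c : edge_coloring n k,
    has_rainbow_copy c G \/ has_monochromatic_copy c H.

(* gr_k(G, H) = n.  A relation, so that no junk value is involved when no n has
   the property: stating a bound then includes the existence of gr_k(G, H). *)
Definition is_gallai_ramsey (k : nat) (G H : sgraph) (n : nat) : Prop :=
  gallai_ramsey_prop k G H n /\
  forall m : nat, gallai_ramsey_prop k G H m -> n <= m.

(* Main.v *)
(** Write [s] for the order of the tree and suppose that the vertex set has at
    least [(s - 1) M] elements, with [M > 1].  If at every vertex each color
    class of incident edges has fewer than [M] elements, a rainbow copy of the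
    tree is grown greedily: once [m < s] vertices and [m - 1] colors are used,
    extending the copy at a given vertex excludes at most
    [m + (m - 1)(M - 1) <= 1 + (s - 2) M < (s - 1) M] vertices.  Otherwise some
    vertex has [M] neighbors in one color, and one recurses into that
    neighborhood as in the classical proof of Ramsey's theorem, losing a factor
    [s - 1] each time the clique size wanted in one of the colors drops. *)
Require Import Defs.
From mathcomp Require Import all_boot zify.
From Stdlib Require Import Classical.

Set Implicit Arguments.
Unset Strict Implicit.
Unset Printing Implicit Defensive.

(** * Connected vertex sets in a tree *)

Section Trees.
Variable T : sgraph.

(** The subgraph induced on [S], kept as a relation on all of [T] so that [connect] applies without
    a subtype. *)
Definition adj_in (S : {set T}) : rel T :=
  [rel x y | [&& x \in S, y \in S & adj x y]].

Lemma adj_in_connect_sym (S : {set T}) : connect_sym (adj_in S).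
Proof.
apply: symmetric_from_pre => x y.
suff: forall u v, connect (adj_in S) u v -> connect (adj_in S) v u by apply.
move=> {x y} u v /connectP[p]; elim: p u => [|w p IHp] u /=.
  by move=> _ ->; apply: connect0.
case/andP=> /and3P[uS wS uw] wp /(IHp _ wp) vw.
apply: connect_trans vw (connect1 _).
by rewrite /adj_in /= uS wS adj_sym.
Qed.

(** Two distinct neighbors of [y], joined by a path inside [S], would close a cycle through [y] of
    length at least 3. Hence adding [y] to a connected part of a tree creates at most one new
    edge. *)
Lemma acyclic_unique_neighbor (S : {set T}) (x x' y : T) :
  acyclic T -> connect (adj_in S) x x' -> x \in S -> x' \in S -> y \notin S ->
  adj x y -> adj x' y -> x = x'.
Proof.
move=> acT /connectP[p0 p0P ->] {x'} xS.
(* A cycle in the sense of [ucycle] must be duplicate-free, so the path is shortened first; the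
   empty path gives [x = x']. *)
case: (shortenP p0P) => -[//|z p] pP up _ lastS yS xy ly.
have inS: all (mem S) (z :: p).
  elim: (z :: p) x pP {up lastS ly p0P xS xy} => //= w q IHq u.
  by case/andP=> /and3P[_ wS _] /IHq ->; rewrite wS.
have pT: path (@adj T) x (z :: p).
  by apply: sub_path pP => u v /and3P[].
suff /acT: ucycle (@adj T) [:: y, x, z & p] by [].
rewrite /ucycle; apply/andP; split; last first.
  rewrite cons_uniq up andbT inE negb_or; apply/andP; split.
    by apply: contraNneq yS => ->.
  by apply: contraNN yS => /(allP inS).
rewrite /cycle rcons_path; apply/andP; split; last exact: ly.
by rewrite [path _ _ _]/= adj_sym xy.
Qed.

Lemma connected_boundary_edge (S : {set T}) :
  connected T -> S != set0 -> S != setT ->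
  exists x, exists y, [/\ x \in S, y \notin S & adj x y].
Proof.
case=> _ conT /set0Pn[a aS] SnT.
have /subsetPn[b _ bS]: ~~ (setT \subset S) by rewrite subTset.
have /connectP[p pP Eb] := conT a b; subst b.
elim: p a aS pP bS => [|z p IHp] a aS /=; first by rewrite aS.
case/andP=> az zp; have [zS|zS] := boolP (z \in S); first exact: IHp.
by exists a, z.
Qed.

End Trees.

(** * Greedy rainbow copies of a tree *)

Section Colorings.
Variables (V I : finType) (c : {set V} -> I).

Definition color_nbr (A : {set V}) (x : V) (i : I) : {set V} :=
  [set y in A | (y != x) && (c [set x; y] == i)].

Definition rainbow_on (T : sgraph) (S : {set T}) (f : T -> V) : Prop :=
  {in S &, injective f} /\
  forall a b a' b', adj_in S a b -> adj_in S a' b' ->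
    c [set f a; f b] = c [set f a'; f b'] -> [set a; b] = [set a'; b'].

Lemma fresh_vertex (A U : {set V}) (C : {set I}) (r M : nat) (x : V) :
  1 < M -> r * M <= #|A| -> #|U| <= r -> #|C| < #|U| -> x \in U ->
  (forall i, #|color_nbr A x i| < M) ->
  exists v, [/\ v \in A, v \notin U & c [set x; v] \notin C].
Proof.
move=> M1 rM Ur CU xU small.
pose B := U :|: \bigcup_(i in C) color_nbr A x i.
have cardB: #|B| <= #|U| + #|C| * M.-1.
  apply: leq_trans (leq_card_setU _ _) _; rewrite leq_add2l.
  apply: (@leq_trans (\sum_(i in C) #|color_nbr A x i|)).
    elim/big_rec2: _ => [|i m E _ IH]; first by rewrite cards0.
    by apply: leq_trans (leq_card_setU _ _) _; rewrite leq_add2l.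
  by rewrite -sum_nat_const; apply: leq_sum => i _; have := small i; lia.
have /subsetPn[v vA vB]: ~~ (A \subset B).
  apply/negP => /subset_leq_card AB.
  (* The right side equals [1 + (r - 1) M], which is below [r M] because [M > 1]. *)
  have UC : #|U| + #|C| * M.-1 <= r + r.-1 * M.-1.
    by apply: leq_add => //; apply: leq_mul => //; lia.
  have := leq_trans rM (leq_trans AB (leq_trans cardB UC)).
  have r0 : 0 < r by apply: leq_trans Ur; apply: leq_ltn_trans CU.
  by rewrite -(prednK r0) /=; case: M M1 {small rM cardB UC} => //= M M1; nia.
move: vB; rewrite in_setU negb_or => /andP[vU vC].
exists v; split=> //; apply: contraNN vC => vC.
apply/bigcupP; exists (c [set x; v]) => //.
by rewrite inE vA eqxx andbT; apply: contraNneq vU => ->.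
Qed.

Lemma greedy_rainbow_tree (T : sgraph) (A : {set V}) (M : nat) :
  is_tree T -> 1 < #|T| -> 1 < M -> #|T|.-1 * M <= #|A| ->
  (forall x i, x \in A -> #|color_nbr A x i| < M) ->
  exists f : T -> V, rainbow_on setT f.
Proof.
move=> [conT acT] T1 M1 rM small.
(* The part [S] embedded so far is kept connected, so each new vertex brings one edge and hence one
   color: [m] bounds the number of colors for [m + 1] vertices. Values of [f] outside [S] are
   arbitrary. *)
have grow m : m < #|T| -> exists S : {set T}, exists f : T -> V, exists C : {set I},
  [/\ #|S| = m.+1, #|C| <= m & {in S, forall a, f a \in A}] /\
  [/\ rainbow_on S f,
      forall a b, adj_in S a b -> c [set f a; f b] \in C &
      {in S &, forall a b, connect (adj_in S) a b}].
  elim: m => [|m IHm] mT.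
    have [r _] : exists r, r \in T by apply/card_gt0P/ltnW.
    have [v vA] : exists v, v \in A by apply/card_gt0P/(leq_trans _ rM); nia.
    have nadj a b : adj_in [set r] a b = false.
      apply/negP => /and3P[/set1P-> /set1P->]; by rewrite adj_irrefl.
    exists [set r], (fun=> v), set0; rewrite cards1 cards0; split; first by split.
    split=> [|a b|]; rewrite ?nadj //.
      split=> [a b /set1P-> /set1P-> //|a b a' b']; by rewrite nadj.
    by move=> a b /set1P-> /set1P->; apply: connect0.
  have [|S [f [C [[cS cC fA] [[finj frb] fC conS]]]]] := IHm; first lia.
  have [||x [y [xS yS xy]]] := connected_boundary_edge (S := S) conT.
  - by rewrite -card_gt0 cS.
  - by apply: contraTneq mT => ST; rewrite -cS ST cardsT ltnn.
  have cfS: #|f @: S| = m.+1 by rewrite card_in_imset.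
  have [||||v [vA vS vC]] :=
    fresh_vertex (U := f @: S) (C := C) (x := f x) M1 rM.
  - by rewrite cfS; lia.
  - by rewrite cfS; lia.
  - exact: imset_f.
  - by move=> i; apply: small; apply: fA.
  pose g z := if z == y then v else f z.
  have gS z : z \in S -> g z = f z.
    by rewrite /g; case: eqP => // -> zS; rewrite zS in yS.
  have gy : g y = v by rewrite /g eqxx.
  have ux z : z \in S -> adj z y -> z = x.
    move=> zS zy; apply: (acyclic_unique_neighbor acT _ zS xS yS zy xy).
    exact: conS.
  (* An edge inside the enlarged set is either old, with its old color, or the single edge [xy],
     whose color avoids [C]. *)
  have edgeP a b : adj_in (y |: S) a b ->
      adj_in S a b /\ c [set g a; g b] = c [set f a; f b] \/
      [set a; b] = [set x; y] /\ c [set g a; g b] = c [set f x; v].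
    case/and3P=> /setU1P[->|aS] /setU1P[->|bS] ab.
    - by rewrite adj_irrefl in ab.
    - right; rewrite adj_sym in ab; rewrite (ux b bS ab) gy (gS _ xS).
      by split; rewrite setUC.
    - by right; rewrite (ux a aS ab) gy (gS _ xS).
    - by left; rewrite /adj_in /= !gS ?aS ?bS.
  exists (y |: S), g, (c [set f x; v] |: C); split.
    split.
    - by rewrite cardsU1 yS cS.
    - by rewrite cardsU1 vC; lia.
    - by move=> a /setU1P[->|aS]; rewrite ?gy ?gS ?fA.
  have subS u w : adj_in S u w -> adj_in (y |: S) u w.
    by case/and3P=> uS wS uw; rewrite /adj_in /= !inE uS wS uw !orbT.
  split.
  - split.
      move=> a b /setU1P[->|aS] /setU1P[->|bS] //.
      + by rewrite gy gS // => E; rewrite E imset_f in vS.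
      + by rewrite gy gS // => E; rewrite -E imset_f in vS.
      + by rewrite !gS //; apply: finj.
    move=> a b a' b' /edgeP[[ab ->]|[-> ->]] /edgeP[[ab' ->]|[-> ->]] //.
    + exact: frb.
    + by move=> E; rewrite -E fC in vC.
    + by move=> E; rewrite E fC in vC.
  - by move=> a b /edgeP[[ab ->]|[_ ->]]; rewrite !inE ?eqxx ?fC ?orbT.
  have con_x a : a \in y |: S -> connect (adj_in (y |: S)) x a.
    case/setU1P=> [->|aS].
      by apply: connect1; rewrite /adj_in /= !inE eqxx xS xy orbT.
    apply: connect_sub (conS _ _ xS aS) => u w uw.
    exact/connect1/subS.
  move=> a b aS bS; apply: connect_trans (con_x b bS).
  by rewrite adj_in_connect_sym con_x.
have [|S [f [C [[cS _ _] [rb _ _]]]]] := grow #|T|.-1; first lia.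
exists f; suff <- : S = setT by [].
by apply/eqP; rewrite eqEcard subsetT cardsT cS; lia.
Qed.

(** * The Ramsey recursion *)

Definition mono_clique (B : {set V}) (i : I) : Prop :=
  {in B &, forall x y, x != y -> c [set x; y] = i}.

(** Each color has its own target size [t i], as in off-diagonal Ramsey numbers, so that one target
    can drop while the others stay. The induction is on the bound [K] for their sum. Targets 0 and 1
    are met by an empty set and a singleton, which are cliques of every color. *)
Lemma rainbow_tree_or_mono_clique (T : sgraph) (K : nat) (t : I -> nat)
    (A : {set V}) :
  is_tree T -> 2 < #|T| -> 0 < #|I| -> \sum_i t i <= K -> #|T|.-1 ^ K <= #|A| ->
  (exists f : T -> V, rainbow_on setT f) \/
  exists B : {set V}, exists i,
    [/\ B \subset A, t i <= #|B| & mono_clique B i].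
Proof.
move=> treeT T2 I0; elim: K => [|K IHK] in t A *; move=> tK KA.
  have [i _] := card_gt0P I0; right; exists set0, i; split; first exact: sub0set.
    by move: tK; rewrite (bigD1 i) //= cards0; lia.
  by move=> x y; rewrite inE.
have [/existsP[i ti]|] := boolP [exists i, t i <= 1].
  have [x xA]: exists x, x \in A.
    by apply/card_gt0P; apply: leq_trans KA; rewrite expn_gt0; apply/orP; left; lia.
  right; exists [set x], i; split; first by rewrite sub1set.
    by rewrite cards1.
  by move=> a b /set1P-> /set1P->; rewrite eqxx.
rewrite negb_exists => /forallP t2.
(* All targets are now at least 2, so [K.+1 >= 2]; this makes the threshold [M = #|T|.-1 ^ K] exceed
   1, as the greedy step requires. *)
have K0 : 0 < K.
  have [i _] := card_gt0P I0; have := t2 i.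
  by move: tK; rewrite (bigD1 i) //=; lia.
have M1 : 1 < #|T|.-1 ^ K by rewrite -(exp1n K) ltn_exp2r //; lia.
have [/existsP[x /existsP[i /andP[xA big]]]|small] :=
  boolP [exists x, exists i, (x \in A) && (#|T|.-1 ^ K <= #|color_nbr A x i|)].
(* Only the target of the popular color [i] drops by one: inside the [i]-neighborhood of [x], a
   clique of color [i] can be completed by [x], while one of another color already has its full
   size. *)
- pose t' j := t j - (j == i).
  have t'K : \sum_j t' j <= K.
    have Et: \sum_(j | j != i) t' j = \sum_(j | j != i) t j.
      by apply: eq_bigr => j /negPf ji; rewrite /t' ji subn0.
    move: tK; rewrite (bigD1 i) // [\sum_j t' j](bigD1 i) //= Et /t' eqxx.
    by have := t2 i; lia.
  have [rb|[B [j [BA tB mB]]]] := IHK t' _ t'K big; first by left.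
  have sBA : B \subset A.
    by apply: subset_trans BA _; apply/subsetP => y; rewrite inE => /andP[].
  right; have [Eji|ji] := eqVneq j i; last first.
    by exists B, j; split=> //; move: tB; rewrite /t' (negPf ji) subn0.
  subst j; have BP y : y \in B -> y != x /\ c [set x; y] = i.
    by move/(subsetP BA); rewrite inE => /and3P[_ yx /eqP].
  exists (x |: B), i; split.
  + by rewrite subUset sub1set xA.
  + have xB : x \notin B by apply/negP => /BP[]; rewrite eqxx.
    by move: tB; rewrite cardsU1 xB /t' eqxx; lia.
  + move=> a b /setU1P[->|aB] /setU1P[->|bB] ab.
    * by rewrite eqxx in ab.
    * by have [] := BP b bB.
    * by rewrite setUC; have [] := BP a aB.
    * exact: mB.
- left; apply: (greedy_rainbow_tree treeT _ M1) => //.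
  + exact: ltnW.
  + by rewrite -expnS; exact: KA.
  + move=> x i xA; rewrite ltnNge; apply: contraNN small => big.
    by apply/existsP; exists x; apply/existsP; exists i; rewrite xA.
Qed.

End Colorings.

(** * Copies in the complete graph and the minimum *)

Lemma gallai_ramsey_tree_complete (t k : nat) (T : sgraph) :
  is_tree T -> 2 < #|T| -> 0 < k ->
  gallai_ramsey_prop k T (complete t) (#|T|.-1 ^ (k * t)).
Proof.
move=> treeT T2 k0 c.
(* The same target [t] for each of the [k] colors gives the sum [k * t]. *)
have [|||[f [finj frb]]|[B [i [_ tB mB]]]] :=
  rainbow_tree_or_mono_clique c (K := k * t) (t := fun=> t) (A := setT) treeT T2.
- by rewrite card_ord.
- by rewrite sum_nat_const card_ord.
- by rewrite cardsT card_ord.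
- left; exists f; first by move=> x y; apply: finj; rewrite inE.
  move=> e1 e2; rewrite !inE.
  move=> /existsP[a /existsP[b /andP[ab /eqP->]]].
  move=> /existsP[a' /existsP[b' /andP[ab' /eqP->]]].
  by rewrite !imsetU1 !imset_set1; apply: frb; rewrite /adj_in /= !inE.
(* The clique [B] may have more than [t] vertices; the first [t] in its enumeration form the
   copy. *)
- right; exists (fun j : 'I_t => enum_val (widen_ord tB j)).
    by move=> x y /enum_val_inj/(congr1 val) /= /val_inj.
  have edgeE (e : {set complete t}) : e \in edges (complete t) ->
      c ((fun j : 'I_t => enum_val (widen_ord tB j)) @: e) = i.
    rewrite inE => /existsP[a /existsP[b /andP[ab /eqP->]]].
    rewrite imsetU1 imset_set1; apply: mB; try exact: enum_valP.
    by apply: contraNneq ab => /enum_val_inj/(congr1 val) /= /val_inj->.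
  by move=> e1 e2 /edgeE-> /edgeE->.
Qed.

(** The least number principle for a predicate with no decision procedure, whence the excluded
    middle. It turns one number with the Ramsey property into both the existence of the minimum and
    a bound on it. *)
Lemma ex_least_leq (P : nat -> Prop) (n : nat) :
  P n -> exists2 m, P m /\ (forall l, P l -> m <= l) & m <= n.
Proof.
elim/ltn_ind: n => n IHn Pn.
have [[m [mn Pm]]|least] := classic (exists m, m < n /\ P m).
  by have [l Pl lm] := IHn m mn Pm; exists l => //; lia.
exists n => //; split=> // l Pl; rewrite leqNgt; apply/negP => ln.
by apply: least; exists l.
Qed.

Theorem theorem1p15 (s t k : nat) (T : sgraph)
    (hs : 2 < s) (hk : 0 < k) (hT : is_tree T) (hTs : graph_order T = s) :
  exists2 n : nat, is_gallai_ramsey k T (complete t) n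
                 & n <= (s - 1) ^ (k * t).
Proof.
rewrite -hTs subn1; apply: ex_least_leq.
by apply: gallai_ramsey_tree_complete => //; rewrite -/(graph_order T) hTs.
Qed.
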